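(* There exist real constants $C$ and $\lambda$ with $|C-0.6436|\le 5\times10^{-5}$ and $|\lambda-1.4902|\le5\times10^{-5}$ such that $$a(n)\sim C\,\lambda^n\qquad\text{as } n\to\infty.$$
   Context: The sequence $a(n)$, $n\ge0$, is defined by $a(0)=a(1)=a(2)=1$, $a(3)=3$ and $a(n)=2a(n-2)+a(n-3)-a(n-4)$ for $n\ge4$. (Equivalently, $a(n)$ is the number of compositions of $n$, i.e. sequences of positive integers with sum $n$, in which no two adjacent parts have the same parity.) The notation $u_n\sim v_n$ means $u_n/v_n\to1$ as $n\to\infty$. *)

(* Defs.v *)
(* Stdlib real numbers, with Coquelicot limits. *)
From Stdlib Require Import ZArith Reals.
From Coquelicot Require Import Coquelicot.

(* The recurrence subtracts, hence values in Z.  In the last case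
   n = m + 4, p3 = n - 3 and p2 = n - 2. *)
Fixpoint a (n : nat) : Z :=
  match n with
  | 0 | 1 | 2 => 1%Z
  | 3 => 3%Z
  | S (S (S (S m as p3) as p2)) => (2 * a p2 + a p3 - a m)%Z
  end.

(* Division is total in R: this is the usual notion when v is eventually
   nonzero. *)
Definition asymp_equiv (u v : nat -> R) : Prop :=
  is_lim_seq (fun n => u n / v n)%R 1%R.

(* Main.v *)
(* The characteristic polynomial x^4 - 2x^2 - x + 1 factors as
   (x - l)(x - m)(x^2 + (l + m) x + t) with l = 1.4902..., m = 0.52... and a
   complex pair of roots of modulus sqrt t < 1.2.  The coefficient C of l^n is
   the value at n = 0 of the linear form in four consecutive terms that
   annihilates the other three modes, divided by the derivative at l.  The
   remainder c(n) = a(n) - C l^n is O(1.2^n): dividing out the root m leaves a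
   second order recurrence, for which the positive definite form
   x(n+1)^2 + s x(n) x(n+1) + t x(n)^2 is multiplied by t at each step. *)
Require Import Defs.
From Stdlib Require Import ZArith Reals Lra.
From Coquelicot Require Import Coquelicot.
Open Scope R_scope.

Definition charpoly (x : R) : R := x ^ 4 - 2 * x ^ 2 - x + 1.

Lemma continuity_charpoly : continuity charpoly.
Proof. unfold charpoly; reg. Qed.

(** The bracket is tighter than the tolerance on [lambda]: [leading_coef l] has slope about -0.95
    there, and its own bounds need this precision. *)
Lemma dominant_root : exists l, 1.49021 <= l <= 1.49022 /\ charpoly l = 0.
Proof.
  destruct (IVT charpoly 1.49021 1.49022 continuity_charpoly) as [l Hl];
    [lra | unfold charpoly; lra | unfold charpoly; lra | now exists l].
Qed.

Lemma small_root : exists m, 0.52 <= m <= 0.53 /\ charpoly m = 0.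
Proof.
  (* [charpoly] decreases through this root, whereas [IVT] expects a change from negative to
     positive. *)
  destruct (IVT (- charpoly)%F 0.52 0.53) as [m [Hm Hm0]].
  - apply continuity_opp, continuity_charpoly.
  - lra.
  - unfold opp_fct, charpoly; lra.
  - unfold opp_fct, charpoly; lra.
  - exists m; unfold opp_fct in Hm0; split; [exact Hm | lra].
Qed.

Lemma elliptic_recurrence_bound (s t r : R) (x : nat -> R) :
  s ^ 2 < 4 * t -> t <= r ^ 2 -> 0 < r ->
  (forall n, x (S (S n)) = - s * x (S n) - t * x n) ->
  exists K, forall n, Rabs (x n) <= K * r ^ n.
Proof.
  intros Hst Htr Hr Hx.
  set (Q n := x (S n) ^ 2 + s * x n * x (S n) + t * x n ^ 2).
  assert (Ht : 0 < t) by nra.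
  (* Complete the square in [x (S n)]. *)
  assert (HQ : forall n, (t - s ^ 2 / 4) * x n ^ 2 <= Q n).
  { intro n; unfold Q; pose proof (pow2_ge_0 (x (S n) + s / 2 * x n)); nra. }
  assert (HQ0 : forall n, 0 <= Q n).
  { intro n; pose proof (HQ n); pose proof (pow2_ge_0 (x n)); nra. }
  assert (HQb : forall n, Q n <= Q 0%nat * (r ^ n) ^ 2).
  { induction n as [|n IH]; [simpl; lra|].
    replace (Q (S n)) with (t * Q n) by (unfold Q; rewrite Hx; ring).
    apply Rle_trans with (r ^ 2 * (Q 0%nat * (r ^ n) ^ 2)).
    - apply Rmult_le_compat; auto with real.
    - right; simpl; ring. }
  set (e := t - s ^ 2 / 4) in *.
  assert (He : 0 < e) by (unfold e; lra).
  exists (sqrt (Q 0%nat / e)); intro n.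
  assert (Hq : 0 <= Q 0%nat / e) by (apply Rdiv_le_0_compat; auto).
  pose proof (pow_lt r n Hr) as Hrn.
  rewrite <- (Rabs_pos_eq (sqrt _ * _)).
  2: apply Rmult_le_pos; [apply sqrt_pos | lra].
  apply Rsqr_le_abs_0; rewrite Rsqr_mult, Rsqr_sqrt by exact Hq.
  apply Rmult_le_reg_l with e; [exact He|].
  replace (e * (Q 0%nat / e * Rsqr (r ^ n))) with (Q 0%nat * (r ^ n) ^ 2)
    by (unfold Rsqr; field; lra).
  replace (e * Rsqr (x n)) with (e * x n ^ 2) by (unfold Rsqr; ring).
  eapply Rle_trans; [apply HQ | apply HQb].
Qed.

Lemma affine_recurrence_bound (m r K : R) (c d : nat -> R) :
  Rabs m < r ->
  (forall n, c (S n) = m * c n + d n) ->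
  (forall n, Rabs (d n) <= K * r ^ n) ->
  exists L, forall n, Rabs (c n) <= L * r ^ n.
Proof.
  intros Hm Hc Hd.
  (* The second argument gives [|m| L + K <= L r], which closes the induction. *)
  set (L := Rmax (Rabs (c 0%nat)) (K / (r - Rabs m))).
  assert (HL : K <= L * (r - Rabs m)).
  { apply Rle_div_l; [lra | apply Rmax_r]. }
  exists L; induction n as [|n IH].
  - rewrite Rmult_1_r; apply Rmax_l.
  - rewrite Hc.
    eapply Rle_trans; [apply Rabs_triang|]; rewrite Rabs_mult.
    pose proof (Rabs_pos m); pose proof (Hd n).
    assert (Hrn : 0 < r ^ n) by (apply pow_lt; lra).
    pose proof (Rmult_le_compat_l _ _ _ (Rabs_pos m) IH).
    pose proof (Rmult_le_compat_r _ _ _ (Rlt_le _ _ Hrn) HL).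
    simpl; lra.
Qed.

Lemma asymp_equiv_geometric (u : nat -> R) (C l r L : R) :
  C <> 0 -> 0 <= r < l ->
  (forall n, Rabs (u n - C * l ^ n) <= L * r ^ n) ->
  asymp_equiv u (fun n => C * l ^ n).
Proof.
  intros HC Hrl Hu; unfold asymp_equiv.
  assert (Hln : forall n, 0 < l ^ n) by (intro; apply pow_lt; lra).
  assert (Hlim : is_lim_seq (fun n => L / Rabs C * (r / l) ^ n) 0).
  { replace (Finite 0) with (Rbar_mult (L / Rabs C) 0)
      by (simpl; f_equal; ring).
    apply is_lim_seq_scal_l, is_lim_seq_geom.
    rewrite Rabs_pos_eq by (apply Rdiv_le_0_compat; lra).
    apply Rlt_div_l; lra. }
  apply is_lim_seq_ext with (fun n => 1 + (u n - C * l ^ n) / (C * l ^ n)).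
  { intro n; specialize (Hln n); field; split; lra. }
  replace (Finite 1) with (Finite (1 + 0)) by (f_equal; ring).
  apply is_lim_seq_plus'; [apply is_lim_seq_const|].
  apply is_lim_seq_abs_0.
  apply is_lim_seq_le_le with (fun _ => 0) (fun n => L / Rabs C * (r / l) ^ n);
    [| apply is_lim_seq_const | exact Hlim].
  intro n; split; [apply Rabs_pos|].
  specialize (Hln n); pose proof (Rabs_pos_lt _ HC).
  rewrite Rabs_div, Rabs_mult, (Rabs_pos_eq (l ^ n)) by nra.
  unfold Rdiv at 3; rewrite Rpow_mult_distr, pow_inv.
  apply Rle_div_l; [nra|].
  replace (L / Rabs C * (r ^ n * / l ^ n) * (Rabs C * l ^ n)) with (L * r ^ n)
    by (field; lra).
  apply Hu.
Qed.

Lemma a_recurrence (n : nat) :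
  IZR (a (S (S (S (S n))))) =
  2 * IZR (a (S (S n))) + IZR (a (S n)) - IZR (a n).
Proof.
  change (a (S (S (S (S n))))) with (2 * a (S (S n)) + a (S n) - a n)%Z.
  now rewrite minus_IZR, plus_IZR, mult_IZR.
Qed.

(* The numerator below is [a 3 + l * a 2 + (l^2 - 2) * a 1 +
   (l^3 - 2 * l - 1) * a 0], with coefficients those of
   [charpoly x / (x - l)]; the denominator is [charpoly' l]. *)
Definition leading_coef (l : R) : R :=
  (l ^ 3 + l ^ 2 - l) / (4 * l ^ 3 - 4 * l - 1).

Lemma leading_coef_bounds (l : R) :
  1.49021 <= l <= 1.49022 -> 0.64355 <= leading_coef l <= 0.64365.
Proof.
  intro Hl; unfold leading_coef.
  (* Expanding at the left endpoint makes both inequalities linear in the small quantities [h],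
     [h^2], [h^3]. *)
  replace l with (1.49021 + (l - 1.49021)) by ring.
  set (h := l - 1.49021).
  assert (H1 : 0 <= h <= 0.00001) by (unfold h; lra).
  assert (H2 : 0 <= h ^ 2 <= 0.00001 * h) by (simpl; nra).
  assert (H3 : 0 <= h ^ 3 <= h ^ 2) by (simpl in *; nra).
  split; [apply -> Rle_div_r | apply <- Rle_div_l]; lra.
Qed.

(** Since its coefficients are those of [charpoly x / (x - l)], the form is multiplied by [l] when
    [n] increases by one; the choice of [leading_coef] makes it vanish at [n = 0]. *)
Lemma remainder_recurrence (l : R) (c : nat -> R) :
  1.49021 <= l <= 1.49022 -> charpoly l = 0 ->
  (forall n, c n = IZR (a n) - leading_coef l * l ^ n) ->
  forall n, c (S (S (S n))) + l * c (S (S n)) + (l ^ 2 - 2) * c (S n)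
            + (l ^ 3 - 2 * l - 1) * c n = 0.
Proof.
  intros Hl Hp Hc.
  assert (HD : 4 * l ^ 3 - 4 * l - 1 <> 0) by nra.
  induction n as [|n IH].
  - rewrite !Hc; simpl a; unfold leading_coef; field; exact HD.
  - assert (Hr : c (S (S (S (S n)))) = 2 * c (S (S n)) + c (S n) - c n).
    { rewrite !Hc, a_recurrence.
      (* The last factor is [l^4], written so that [charpoly l] can be replaced by 0. *)
      transitivity (2 * IZR (a (S (S n))) + IZR (a (S n)) - IZR (a n)
        - leading_coef l * l ^ n * (charpoly l + 2 * l ^ 2 + l - 1));
        [unfold charpoly | rewrite Hp]; simpl; ring. }
    rewrite Hr.
    transitivity (l * (c (S (S (S n))) + l * c (S (S n)) + (l ^ 2 - 2) * c (S n)
      + (l ^ 3 - 2 * l - 1) * c n) - charpoly l * c n);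
      [unfold charpoly; ring | rewrite IH, Hp; ring].
Qed.

Lemma remainder_bound (l : R) :
  1.49021 <= l <= 1.49022 -> charpoly l = 0 ->
  exists L, forall n,
    Rabs (IZR (a n) - leading_coef l * l ^ n) <= L * 1.2 ^ n.
Proof.
  intros Hl Hp.
  destruct small_root as [m [Hm Hpm]].
  set (c n := IZR (a n) - leading_coef l * l ^ n).
  pose proof (remainder_recurrence l c Hl Hp (fun n => eq_refl)) as Hc.
  set (t := l ^ 2 + l * m + m ^ 2 - 2).
  (* Vieta: the divided difference of charpoly at l and m vanishes. *)
  assert (Ht : l ^ 3 - 2 * l - 1 = - m * t).
  { apply Rmult_eq_reg_l with (l - m); [|lra].
    unfold charpoly in Hp, Hpm; unfold t; nra. }
  (* The cubic of [Hc] is [(x - m) (x^2 + (l + m) x + t)], so [c (S n) - m * c n] obeys the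
     recurrence of the quadratic factor. Numerically [t] is about 1.28, below [1.2^2], and
     [(l + m)^2] about 4.06, below [4 t]. *)
  destruct (elliptic_recurrence_bound (l + m) t 1.2
    (fun n => c (S n) - m * c n)) as [K HK].
  - unfold t; nra.
  - unfold t; nra.
  - lra.
  - intro n; specialize (Hc n); rewrite Ht in Hc.
    replace (l ^ 2 - 2) with (t - m * (l + m)) in Hc by (unfold t; ring).
    lra.
  - apply (affine_recurrence_bound m 1.2 K c (fun n => c (S n) - m * c n)).
    + rewrite Rabs_pos_eq; lra.
    + intro n; ring.
    + exact HK.
Qed.

Theorem theorem9 :
  exists C lambda : R,
    Rabs (C - 0.6436) <= 5 / 10 ^ 5 /\
    Rabs (lambda - 1.4902) <= 5 / 10 ^ 5 /\
    asymp_equiv (fun n => IZR (a n)) (fun n => C * lambda ^ n).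
Proof.
  destruct dominant_root as [l [Hl Hp]].
  pose proof (leading_coef_bounds l Hl) as HC.
  destruct (remainder_bound l Hl Hp) as [L HL].
  exists (leading_coef l), l; split; [|split].
  - apply Rabs_le; lra.
  - apply Rabs_le; lra.
  - apply asymp_equiv_geometric with 1.2 L; [lra | lra | exact HL].
Qed.
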